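(* Let $p>2$ be a prime number and let $\mathbf{Q}_p$ be the field of $p$-adic numbers. Let $\xi$ and $\eta$ be independent identically distributed random variables with values in $\mathbf{Q}_p$ and distribution $\mu$. Assume that $\mu$ has a density $\rho$ with respect to the Haar measure $m_{\mathbf{Q}_p}$ such that $\rho$ is continuous. Then the random variables $S=\xi+\eta$ and $D=(\xi-\eta)^2$ are independent if and only if $\mu\in I(\mathbf{Q}_p)$, i.e. $\mu$ is an idempotent distribution on $\mathbf{Q}_p$.
   Context: $\mathbf{Q}_p$ carries its usual locally compact topology given by the $p$-adic norm $|\cdot|_p$; $\mathbf{Z}_p$ is the ring of $p$-adic integers; $m_{\mathbf{Q}_p}$ is the Haar measure on the additive group $\mathbf{Q}_p$ normalized by $m_{\mathbf{Q}_p}(\mathbf{Z}_p)=1$. For a compact subgroup $K$ of the additive group $\mathbf{Q}_p$, $m_K$ denotes the Haar distribution of $K$, i.e. the Haar measure on $K$ normalized by $m_K(K)=1$ and regarded as a probability measure on $\mathbf{Q}_p$. $I(\mathbf{Q}_p)$ denotes the set of all idempotent distributions on $\mathbf{Q}_p$, i.e. the set of all shifts (translates by elements of $\mathbf{Q}_p$) of Haar distributions $m_K$ of compact subgroups $K$ of the additive group $\mathbf{Q}_p$. *)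

(* Defs.v *)
From HB Require Import structures.
From mathcomp Require Import all_boot all_order all_algebra.
From mathcomp Require Import ring.
From mathcomp Require Import all_classical all_reals all_analysis.

Set Implicit Arguments.
Unset Strict Implicit.
Unset Printing Implicit Defensive.

Import Order.TTheory GRing.Theory Num.Theory.
Import numFieldNormedType.Exports.

Local Open Scope classical_set_scope.
Local Open Scope ring_scope.

Definition ratpnorm (p : nat) (x : rat) : rat :=
  if x == 0 then 0
  else p%:R ^ ((logn p `|denq x|%N)%:Z - (logn p `|numq x|%N)%:Z).

Section ratpnorm_theory.
Variables (p : nat) (p_pr : prime p).
Local Notation nm := (ratpnorm p).

Let p_gt0 : 0 < p%:R :> rat.
Proof. by rewrite ltr0n prime_gt0. Qed.

Let p_neq0 : p%:R != 0 :> rat.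
Proof. by rewrite gt_eqF. Qed.

Lemma ratpnorm0 : nm 0 = 0.
Proof. by rewrite /ratpnorm eqxx. Qed.

Lemma ratpnorm_gt0 x : (0 < nm x) = (x != 0).
Proof.
by rewrite /ratpnorm; case: eqP => _; [rewrite ltxx | rewrite exprz_gt0].
Qed.

Lemma ratpnorm_ge0 x : 0 <= nm x.
Proof.
have [->|x0] := eqVneq x 0; first by rewrite ratpnorm0.
by apply: ltW; rewrite ratpnorm_gt0.
Qed.

Lemma ratpnorm_eq0 x : (nm x == 0) = (x == 0).
Proof. by rewrite -[RHS]negbK -ratpnorm_gt0 lt_def ratpnorm_ge0 andbT negbK. Qed.

Lemma ratpnorm_frac (a b : int) : a != 0 -> b != 0 ->
  nm (a%:~R / b%:~R) = p%:R ^ ((logn p `|b|%N)%:Z - (logn p `|a|%N)%:Z).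
Proof.
move=> a0 b0; set x := _ / _.
have x0 : x != 0 by rewrite mulf_neq0 ?invr_eq0 ?intr_eq0.
rewrite /ratpnorm (negbTE x0); congr (_ ^ _).
have E : a * denq x = numq x * b.
  apply: (@intr_inj rat); rewrite !intrM; apply/eqP.
  by rewrite -eqr_div ?intr_eq0 ?denq_eq0// divq_num_den.
have [n0 d0] : numq x != 0 /\ denq x != 0 by rewrite numq_eq0 denq_eq0.
have := congr1 (fun z : int => logn p `|z|%N) E.
rewrite !abszM !lognM ?absz_gt0//= => H.
apply/eqP; rewrite subr_eq addrAC eq_sym subr_eq -!PoszD eqz_nat addnC -H.
by rewrite addnC.
Qed.

Lemma ratpnormM x y : nm (x * y) = nm x * nm y.
Proof.
have [->|x0] := eqVneq x 0; first by rewrite mul0r ratpnorm0 mul0r.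
have [->|y0] := eqVneq y 0; first by rewrite mulr0 ratpnorm0 mulr0.
have -> : x * y = (numq x * numq y)%:~R / (denq x * denq y)%:~R.
  by rewrite -{1}(divq_num_den x) -{1}(divq_num_den y) !intrM mulf_div.
rewrite ratpnorm_frac ?mulf_neq0 ?numq_eq0 ?denq_eq0//.
rewrite /ratpnorm (negbTE x0) (negbTE y0) -expfzDr//; congr (_ ^ _).
rewrite !abszM !lognM ?absz_gt0 ?numq_eq0 ?denq_eq0//.
by rewrite !PoszD opprD addrACA.
Qed.

Lemma ratpnorm1 : nm 1 = 1.
Proof.
have /eqP := ratpnormM 1 1; rewrite mulr1 -[X in X == _]mulr1.
have n1 : nm 1 != 0 by rewrite ratpnorm_eq0 oner_neq0.
by rewrite (inj_eq (mulfI n1)) => /eqP.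
Qed.

Lemma ratpnormN x : nm (- x) = nm x.
Proof. by rewrite /ratpnorm oppr_eq0 numqN denqN abszN. Qed.

Lemma ratpnormB x y : nm (x - y) = nm (y - x).
Proof. by rewrite -ratpnormN opprB. Qed.

Lemma ratpnormV x : nm x^-1 = (nm x)^-1.
Proof.
have [->|x0] := eqVneq x 0; first by rewrite ?(invr0, ratpnorm0).
have n0 : nm x != 0 by rewrite ratpnorm_eq0.
by apply: (mulfI n0); rewrite -ratpnormM !divff// ratpnorm1.
Qed.

Lemma ler_ratpnormD x y : nm (x + y) <= Num.max (nm x) (nm y).
Proof.
have [->|x0] := eqVneq x 0; first by rewrite add0r ratpnorm0 le_max lexx orbT.
have [->|y0] := eqVneq y 0; first by rewrite addr0 ratpnorm0 le_max lexx.
have [->|xy0] := eqVneq (x + y) 0; first by rewrite ratpnorm0 le_max ratpnorm_ge0.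
pose a := numq x * denq y; pose b := numq y * denq x; pose d := denq x * denq y.
have d0 : d != 0 by rewrite mulf_neq0 ?denq_eq0.
have dq0 : d%:~R != 0 :> rat by rewrite intr_eq0.
have dx : (denq x)%:~R != 0 :> rat by rewrite intr_eq0 denq_eq0.
have dy : (denq y)%:~R != 0 :> rat by rewrite intr_eq0 denq_eq0.
have xE : x = a%:~R / d%:~R.
  by rewrite -[LHS]divq_num_den /a /d !intrM -mulf_div divff// mulr1.
have yE : y = b%:~R / d%:~R.
  by rewrite -[LHS]divq_num_den /b /d !intrM [in RHS](mulrC (denq x)%:~R (denq y)%:~R)
    -mulf_div divff// mulr1.
have xyE : x + y = (a + b)%:~R / d%:~R by rewrite {1}xE {1}yE -mulrDl intrD.
have a0 : a != 0 by rewrite mulf_neq0 ?numq_eq0 ?denq_eq0.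
have b0 : b != 0 by rewrite mulf_neq0 ?numq_eq0 ?denq_eq0.
have ab0 : a + b != 0.
  by apply: contraNneq xy0 => ab0; rewrite xyE ab0 mul0r.
have p1 : 1 < p%:R :> rat by rewrite ltr1n prime_gt1.
rewrite xyE xE yE !ratpnorm_frac// le_max !ler_eXz2l// !lerD2l !lerN2 !lez_nat -geq_min.
rewrite -pfactor_dvdn ?absz_gt0//.
suff : ((p ^ minn (logn p `|a|) (logn p `|b|))%N%:Z %| a + b)%Z by [].
by apply: rpredD; rewrite dvdzE/= pfactor_dvdn ?absz_gt0// ?geq_minl ?geq_minr.
Qed.

End ratpnorm_theory.

(* The primality proof is a parameter of pcauchy, pnull and padic because the
   algebraic instances declared on them hold only for prime p. *)
Definition pcauchy (p : nat) (p_pr : prime p) : {pred nat -> rat} :=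
  fun u => `[< forall e : rat, 0 < e -> exists N, forall m n,
    (N <= m)%N -> (N <= n)%N -> ratpnorm p (u m - u n) < e >].

Section pcauchy_ring.
Variables (p : nat) (p_pr : prime p).
Local Notation nm := (ratpnorm p).

Lemma ratpnorm_addlt x y e : nm x < e -> nm y < e -> nm (x + y) < e.
Proof.
by move=> xe ye; rewrite (le_lt_trans (ler_ratpnormD p_pr x y))// gt_max xe.
Qed.

Lemma pcauchy_bounded u : u \in pcauchy p_pr ->
  exists N B, 0 < B /\ forall n, (N <= n)%N -> nm (u n) < B.
Proof.
move=> /asboolP/(_ 1 ltr01)[N uN]; exists N, (Num.max 1 (nm (u N)) + 1).
have h : Num.max 1 (nm (u N)) < Num.max 1 (nm (u N)) + 1 by rewrite ltrDl.
split=> [|n Nn]; first by rewrite (lt_trans _ h)// lt_max ltr01.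
rewrite (le_lt_trans _ h)// -[u n](subrK (u N)).
rewrite (le_trans (ler_ratpnormD p_pr _ _))// ge_max !le_max lexx orbT andbT.
by rewrite ltW// uN.
Qed.

Lemma pcauchy_subring_closed : subring_closed (pcauchy p_pr).
Proof.
split.
- apply/asboolP => e e0; exists 0%N => m n _ _.
  by rewrite subrr ratpnorm0.
- move=> u v /asboolP uC /asboolP vC; apply/asboolP => e e0.
  have [N uN] := uC e e0; have [M vM] := vC e e0.
  exists (maxn N M) => m n; rewrite !geq_max => /andP[Nm Mm] /andP[Nn Mn].
  have -> : (u - v) m - (u - v) n = (u m - u n) + - (v m - v n).
    by change (u m - v m - (u n - v n) = (u m - u n) + - (v m - v n)); ring.
  by apply: ratpnorm_addlt; rewrite ?ratpnormN ?uN ?vM.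
- move=> u v uP vP.
  have [N1 [A [A0 uA]]] := pcauchy_bounded uP.
  have [N2 [B [B0 vB]]] := pcauchy_bounded vP.
  move: uP vP => /asboolP uC /asboolP vC; apply/asboolP => e e0.
  have [N uN] := uC _ (divr_gt0 e0 B0); have [M vM] := vC _ (divr_gt0 e0 A0).
  exists (maxn (maxn N M) (maxn N1 N2)) => m n.
  rewrite !geq_max => /andP[/andP[Nm Mm] /andP[N1m N2m]].
  move=> /andP[/andP[Nn Mn] /andP[N1n N2n]].
  have -> : (u * v) m - (u * v) n = (u m - u n) * v m + u n * (v m - v n).
    change (u m * v m - u n * v n = (u m - u n) * v m + u n * (v m - v n)).
    by ring.
  apply: ratpnorm_addlt; rewrite ratpnormM//.
    rewrite -[ltRHS](divfK (lt0r_neq0 B0)).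
    by apply: ltr_pM; rewrite ?ratpnorm_ge0 ?uN ?vB.
  rewrite -[ltRHS](divfK (lt0r_neq0 A0)) mulrC.
  by apply: ltr_pM; rewrite ?ratpnorm_ge0 ?vM ?uA.
Qed.

HB.instance Definition _ :=
  GRing.isSubringClosed.Build (nat -> rat) (pcauchy p_pr)
    pcauchy_subring_closed.

End pcauchy_ring.

Record pcseq (p : nat) (p_pr : prime p) :=
  PCSeq { pcseq_val :> nat -> rat; pcseqP : pcseq_val \in pcauchy p_pr }.

HB.instance Definition _ (p : nat) (p_pr : prime p) :=
  [isSub for @pcseq_val p p_pr].
HB.instance Definition _ (p : nat) (p_pr : prime p) :=
  [Choice of pcseq p_pr by <:].
HB.instance Definition _ (p : nat) (p_pr : prime p) :=
  [SubChoice_isSubComNzRing of pcseq p_pr by <:].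

Definition pnull (p : nat) (p_pr : prime p) : {pred pcseq p_pr} :=
  fun u => `[< forall e : rat, 0 < e ->
    exists N, forall n, (N <= n)%N -> ratpnorm p (u n) < e >].

Arguments pnull {p} p_pr _.

Section pnull_ideal.
Variables (p : nat) (p_pr : prime p).
Local Notation nm := (ratpnorm p).
Implicit Types u v : pcseq p_pr.

Lemma pnull_idealr_closed : idealr_closed (pnull p_pr).
Proof.
split.
- by apply/asboolP => e e0; exists 0%N => n _; rewrite [_ n]/(0 : rat) ratpnorm0.
- apply/negP => /asboolP/(_ 1 ltr01)[N /(_ N (leqnn _))].
  by rewrite [_ N]/(1 : rat) ratpnorm1// ltxx.
- move=> u v w /asboolP vN /asboolP wN; apply/asboolP => e e0.
  have [N1 [A [A0 uA]]] := pcauchy_bounded (pcseqP u).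
  have [N vN'] := vN _ (divr_gt0 e0 A0); have [M wM] := wN e e0.
  exists (maxn N1 (maxn N M)) => n; rewrite !geq_max => /and3P[N1n Nn Mn].
  have -> : (u * v + w) n = u n * v n + w n by [].
  apply: (ratpnorm_addlt p_pr); last exact: wM.
  rewrite ratpnormM// -[ltRHS](divfK (lt0r_neq0 A0)) mulrC.
  by apply: ltr_pM; rewrite ?ratpnorm_ge0 ?vN' ?uA.
Qed.

HB.instance Definition _ :=
  isIdealr.Build (pcseq p_pr) (pnull p_pr) pnull_idealr_closed.

Lemma ratpnorm_isosceles (x y : rat) : nm (x - y) < nm y -> nm x = nm y.
Proof.
move=> xy; apply/eqP; rewrite eq_le; apply/andP; split.
  rewrite -[x](subrK y) (le_trans (ler_ratpnormD p_pr _ _))// ge_max lexx.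
  by rewrite ltW.
rewrite leNgt; apply/negP => xlt; have := ltxx (nm y).
rewrite -[X in nm X < _](subKr x y) -[x - (x - y)]addrC.
by rewrite ratpnorm_addlt// ratpnormN.
Qed.

Lemma pcseq_stable u : u \notin pnull p_pr ->
  exists N c, 0 < c /\ forall n, (N <= n)%N -> nm (u n) = c.
Proof.
move=> /asboolPn/existsNP[e /not_implyP[e0 /forallNP h]].
have /asboolP/(_ e e0)[N uN] := pcseqP u.
have /existsNP[n /not_implyP[Nn /negP]] := h N; rewrite -leNgt => een.
exists N, (nm (u n)); split=> [|m Nm]; first exact: lt_le_trans een.
by apply: ratpnorm_isosceles; rewrite (lt_le_trans _ een)// uN.
Qed.

Lemma pcseq_inv u : u \notin pnull p_pr -> exists v, v * u - 1 \in pnull p_pr.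
Proof.
move=> /pcseq_stable[N [c [c0 uN]]].
have u0 n : (N <= n)%N -> u n != 0.
  by move=> Nn; rewrite -(ratpnorm_gt0 p_pr) uN.
have vC : (fun n => (u n)^-1) \in pcauchy p_pr.
  apply/asboolP => e e0; have /asboolP uC := pcseqP u.
  have [M uM] := uC (e * (c * c)) (mulr_gt0 e0 (mulr_gt0 c0 c0)).
  exists (maxn N M) => m n; rewrite !geq_max => /andP[Nm Mm] /andP[Nn Mn].
  have -> : (u m)^-1 - (u n)^-1 = (u n - u m) * ((u m)^-1 * (u n)^-1).
    by field; rewrite !u0.
  rewrite !ratpnormM// !ratpnormV// !uN// -invfM.
  by rewrite ltr_pdivrMr ?mulr_gt0// uM.
exists (PCSeq vC); apply/asboolP => e e0; exists N => n Nn.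
have -> : (PCSeq vC * u - 1) n = (u n)^-1 * u n - 1 by [].
by rewrite mulVf ?u0// subrr ratpnorm0.
Qed.

End pnull_ideal.

(* Qp as the completion of rat: Cauchy sequences modulo null sequences. *)
Definition padic (p : nat) (p_pr : prime p) := {ideal_quot (pnull p_pr)}.

HB.instance Definition _ (p : nat) (p_pr : prime p) :=
  GRing.ComNzRing.on (padic p_pr).

Section padic_field.
Variables (p : nat) (p_pr : prime p).
Local Notation Qp := (padic p_pr).

Definition padic_inv (x : Qp) : Qp :=
  if x == 0 then 0 else xget 0 [set y | y * x = 1].

Lemma padic_pi_eq0 (u : pcseq p_pr) :
  (\pi_({ideal_quot (pnull p_pr)}) u == 0 :> Qp)%qT = (u \in pnull p_pr).
Proof.
rewrite -[in RHS](subr0 u) Quotient.idealrBE.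
by rewrite rmorph0.
Qed.

Lemma padic_mulVf (x : Qp) : x != 0 -> padic_inv x * x = 1.
Proof.
move=> x0; rewrite /padic_inv (negbTE x0).
suff : exists y, y * x = 1 by move/(@xgetPex _ 0 [set y | y * x = 1]).
move: x0; rewrite -[x]reprK padic_pi_eq0 => /pcseq_inv[v vP].
exists (\pi_({ideal_quot (pnull p_pr)}) v)%qT.
by move: vP; rewrite Quotient.idealrBE rmorphM rmorph1 => /eqP.
Qed.

Lemma padic_inv0 : padic_inv 0 = 0.
Proof. by rewrite /padic_inv eqxx. Qed.

HB.instance Definition _ :=
  GRing.ComNzRing_isField.Build Qp padic_mulVf padic_inv0.

End padic_field.

Section padic_norm.
Variables (p : nat) (p_pr : prime p).
Local Notation Qp := (padic p_pr).

Definition padic_norm (x : Qp) : rat :=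
  lim ((ratpnorm p (repr x n) : rat^o) @[n --> \oo]).

Lemma rat_cvgP (f : nat -> rat) (c : rat) :
  (f n : rat^o) @[n --> \oo] --> (c : rat^o) <->
  forall e, 0 < e -> exists N, forall n, (N <= n)%N -> `|f n - c| < e.
Proof.
split=> [/cvgrPdist_lt fc e e0|fc].
  have [N _ Ne] := fc e e0.
  by exists N => n Nn; rewrite distrC; exact: Ne.
apply/cvgrPdist_lt => e e0; have [N Ne] := fc e e0.
by exists N => // n Nn; rewrite distrC; exact: Ne.
Qed.

Lemma ratpnorm_dist (x y : rat) :
  `|ratpnorm p x - ratpnorm p y| <= ratpnorm p (x - y).
Proof.
wlog xy : x y / ratpnorm p y <= ratpnorm p x.
  move=> h; have [|/ltW] := leP (ratpnorm p y) (ratpnorm p x); first exact: h.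
  by rewrite distrC ratpnormB; exact: h.
rewrite ger0_norm ?subr_ge0// lerBlDr -[x in leLHS](subrK y).
by rewrite (le_trans (ler_ratpnormD p_pr _ _))// ge_max lerDl lerDr !ratpnorm_ge0.
Qed.

Lemma pcseq_norm_ex (u : pcseq p_pr) :
  exists c : rat, (ratpnorm p (u n) : rat^o) @[n --> \oo] --> (c : rat^o).
Proof.
have [/asboolP u0|/pcseq_stable[N [c [_ uN]]]] := boolP (u \in pnull p_pr).
  exists 0; apply/rat_cvgP => e /u0[N uN]; exists N => n Nn.
  by rewrite subr0 ger0_norm ?ratpnorm_ge0 ?uN.
exists c; apply/rat_cvgP => e e0; exists N => n Nn.
by rewrite uN// subrr normr0.
Qed.

Lemma padic_normE (x : Qp) (c : rat) :
  (ratpnorm p (repr x n) : rat^o) @[n --> \oo] --> (c : rat^o) ->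
  padic_norm x = c.
Proof. move=> xc. rewrite /padic_norm. 
refine (cvg_lim _ xc); exact: norm_hausdorff.
Qed.

Lemma padic_norm_cvg (u : pcseq p_pr) :
  (ratpnorm p (u n) : rat^o) @[n --> \oo] -->
    (padic_norm (\pi_({ideal_quot (pnull p_pr)})%qT u) : rat^o).
Proof.
set x := (\pi_ _ u)%qT; have [c xc] := pcseq_norm_ex (repr x).
rewrite (padic_normE xc).
have : repr x - u \in pnull p_pr by rewrite Quotient.idealrBE reprK.
move/asboolP => xu; apply/rat_cvgP => e e0.
have e2 : 0 < e / 2 by rewrite divr_gt0.
have [N Nxu] := xu _ e2; have [M Mxc] := (rat_cvgP _ _).1 xc _ e2.
exists (maxn N M) => n; rewrite geq_max => /andP[Nn Mn].
rewrite (splitr e) (le_lt_trans (ler_distD (ratpnorm p (repr x n)) _ _))//.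
rewrite ltrD ?Mxc// distrC (le_lt_trans (ratpnorm_dist _ _))//.
exact: Nxu.
Qed.

Local Arguments padic_norm_cvg : clear implicits.

Lemma rat_cvg_unique (f : nat -> rat) (a b : rat) :
  (f n : rat^o) @[n --> \oo] --> (a : rat^o) ->
  (f n : rat^o) @[n --> \oo] --> (b : rat^o) -> a = b.
Proof.
by move=> fa fb; apply: (cvg_unique _ fa fb); exact: norm_hausdorff.
Qed.

Lemma padic_norm_eq0 (x : Qp) : (padic_norm x == 0) = (x == 0).
Proof.
rewrite -[x]reprK padic_pi_eq0; set u := repr x.
have uc := padic_norm_cvg u.
have [u0|/pcseq_stable[N [c [c0 uN]]]] := boolP (u \in pnull p_pr).
  apply/eqP; apply: (rat_cvg_unique uc); apply/rat_cvgP => e e0.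
  move/asboolP : u0 => /(_ e e0)[N uN]; exists N => n Nn.
  by rewrite subr0 ger0_norm ?ratpnorm_ge0 ?uN.
suff -> : padic_norm (\pi_({ideal_quot (pnull p_pr)})%qT u) = c by exact/gt_eqF.
apply: (rat_cvg_unique uc); apply/rat_cvgP => e e0; exists N => n Nn.
by rewrite uN// subrr normr0.
Qed.

Lemma padic_norm_ge0 (x : Qp) : 0 <= padic_norm x.
Proof.
rewrite -[x]reprK; have /rat_cvgP h := padic_norm_cvg (repr x).
rewrite leNgt; apply/negP; rewrite -oppr_gt0 => /h[N /(_ N (leqnn N))].
by rewrite ltNge (le_trans _ (ler_norm _))// lerDr ratpnorm_ge0.
Qed.

Lemma padic_normN (x : Qp) : padic_norm (- x) = padic_norm x.
Proof.
rewrite -[x]reprK; set u := repr x; apply/esym.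
apply: (rat_cvg_unique (padic_norm_cvg u)).
have := padic_norm_cvg (- u); rewrite rmorphN.
rewrite (_ : (fun n => _) = (fun n => ratpnorm p (u n)))//.
by apply/funext => n; rewrite -[RHS]ratpnormN.
Qed.

Lemma padic_normM (x y : Qp) : padic_norm (x * y) = padic_norm x * padic_norm y.
Proof.
rewrite -[x]reprK -[y]reprK; set u := repr x; set v := repr y.
have := padic_norm_cvg (u * v); rewrite rmorphM => /rat_cvg_unique; apply.
rewrite (_ : (fun n => _) = (fun n => ratpnorm p (u n) * ratpnorm p (v n))).
  exact: (cvgM (padic_norm_cvg u) (padic_norm_cvg v)).
by apply/funext => n; rewrite -ratpnormM.
Qed.

Lemma ler_padic_normD (x y : Qp) :
  padic_norm (x + y) <= Num.max (padic_norm x) (padic_norm y).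
Proof.
rewrite -[x]reprK -[y]reprK; set u := repr x; set v := repr y.
have /rat_cvgP uc := padic_norm_cvg u.
have /rat_cvgP vc := padic_norm_cvg v.
have /rat_cvgP uvc := padic_norm_cvg (u + v).
rewrite -rmorphD; apply/ler_addgt0Pr => e e0.
have e2 : 0 < e / 2 by rewrite divr_gt0.
have [N1 h1] := uc _ e2; have [N2 h2] := vc _ e2; have [N3 h3] := uvc _ e2.
pose n := maxn N1 (maxn N2 N3).
have /h1 : (N1 <= n)%N by rewrite leq_maxl.
have /h2 : (N2 <= n)%N by rewrite /n maxnCA leq_maxl.
have /h3 : (N3 <= n)%N by rewrite /n !leq_max leqnn !orbT.
rewrite !ltr_distl => /andP[a3 _] /andP[_ a2] /andP[_ a1].
rewrite (splitr e) addrA -lerBlDr (le_trans (ltW a3))//.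
rewrite (le_trans (ler_ratpnormD p_pr (u n) (v n)))// ge_max.
apply/andP; split.
  by rewrite (le_trans (ltW a1))// lerD2r le_max lexx.
by rewrite (le_trans (ltW a2))// lerD2r le_max lexx orbT.
Qed.

Lemma padic_norm_ratr (q : rat) : padic_norm (ratr q) = ratpnorm p q.
Proof.
have intE (z : int) : padic_norm z%:~R = ratpnorm p z%:~R.
  have := padic_norm_cvg z%:~R; rewrite rmorph_int => /rat_cvg_unique; apply.
  apply/rat_cvgP => e e0; exists 0%N => n _.
  suff -> : (z%:~R : pcseq p_pr) n = z%:~R by rewrite subrr normr0.
  have natE (k : nat) : (k%:R : pcseq p_pr) n = k%:R.
    elim: k => [//|k ih]; rewrite !mulrS -ih.
    by rewrite -[RHS]/((1 + k%:R : pcseq p_pr) n).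
  case: z => k; first exact: natE.
  by rewrite NegzE !mulrNz -!pmulrn -natE.
have d0 : (denq q)%:~R != 0 :> Qp.
  by rewrite -padic_norm_eq0 intE ratpnorm_eq0// intr_eq0 denq_eq0.
have n0 : padic_norm (denq q)%:~R != 0 by rewrite padic_norm_eq0.
apply: (mulIf n0); rewrite -padic_normM /ratr divfK// !intE -ratpnormM//.
by rewrite -numqE.
Qed.

Lemma padic_dist_xx (x : Qp) : padic_norm (x - x) = 0.
Proof. by apply/eqP; rewrite padic_norm_eq0 subrr. Qed.

Lemma padic_dist_eq0 (x y : Qp) : padic_norm (x - y) = 0 -> x = y.
Proof. by move/eqP; rewrite padic_norm_eq0 subr_eq0 => /eqP. Qed.

Lemma padic_dist_sym (x y : Qp) : padic_norm (x - y) = padic_norm (y - x).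
Proof. by rewrite -padic_normN opprB. Qed.

Lemma padic_dist_triangle (y x z : Qp) :
  padic_norm (x - z) <= padic_norm (x - y) + padic_norm (y - z).
Proof.
rewrite -(subrKA y) (le_trans (ler_padic_normD _ _))// ge_max.
by rewrite lerDl lerDr !padic_norm_ge0.
Qed.

(* The p-adic norm takes values in rat, so the metric structure is over rat;
   this keeps the topology of Qp independent of any model of the reals. *)
HB.instance Definition _ := isMetric.Build rat Qp
  padic_dist_xx padic_dist_eq0 padic_dist_sym padic_dist_triangle.

HB.instance Definition _ := isPointed.Build Qp 0.

HB.instance Definition _ := @isMeasurable.Build (sigma_display (@open Qp)) Qp
  <<s @open Qp >> (@sigma_algebra0 _ setT _) (@sigma_algebraC Qp _)
  (@sigma_algebra_bigcup _ setT _).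

Definition padic_int : set Qp := [set x | padic_norm x <= 1].

Definition compact_subgroup (K : set Qp) :=
  [/\ compact K, K 0 & forall x y, K x -> K y -> K (x - y)].

End padic_norm.

Section distributions.
Variables (p : nat) (p_pr : prime p) (R : realType).
Local Notation Qp := (padic p_pr).
Local Open Scope ereal_scope.

(* Haar measure is characterised rather than constructed: these two conditions
   determine a Borel measure on Qp uniquely. *)
Definition padic_haar_measure (m : {measure set Qp -> \bar R}) :=
  m (@padic_int p p_pr) = 1 /\
  forall (a : Qp) (A : set Qp), measurable A ->
    m [set (a + x)%R | x in A] = m A.

Definition has_density (m : {measure set Qp -> \bar R})
    (mu : probability Qp R) (rho : Qp -> R) :=
  (forall x, 0 <= rho x)%R /\
  forall A : set Qp, measurable A -> mu A = \int[m]_(x in A) (rho x)%:E.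

(* nu K = 1 says that nu is carried by K; its restriction to the Borel subsets
   of K is then the normalized invariant measure of K. *)
Definition haar_distribution (K : set Qp) (nu : probability Qp R) :=
  nu K = 1 /\
  forall (a : Qp) (A : set Qp), K a -> measurable A -> A `<=` K ->
    nu [set (a + x)%R | x in A] = nu A.

Definition idempotent_distribution (mu : probability Qp R) :=
  exists (K : set Qp) (nu : probability Qp R) (a : Qp),
    [/\ compact_subgroup K, haar_distribution K nu &
        forall A : set Qp, measurable A ->
          mu A = pushforward nu (fun x : Qp => a + x)%R A].

End distributions.

Section random_variables.
Context {d d1 d2 : measure_display} {T : measurableType d}
  {U : measurableType d1} {V : measurableType d2} {R : realType}.
Local Open Scope ereal_scope.

Definition has_distribution (P : probability T R) (X : {RV P >-> U})
    (mu : probability U R) :=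
  forall A : set U, measurable A -> distribution P X A = mu A.

Definition independent_rv (P : probability T R) (X : T -> U) (Y : T -> V) :=
  forall (A : set U) (B : set V), measurable A -> measurable B ->
    P (X @^-1` A `&` Y @^-1` B) = P (X @^-1` A) * P (Y @^-1` B).

End random_variables.

(* Main.v *)
From HB Require Import structures.
Require Import Defs.
From mathcomp Require Import all_boot all_order all_algebra cyclic.
From mathcomp Require Import ring lra.
From mathcomp Require Import all_classical all_reals all_analysis.
From mathcomp Require Import measurable_realfun.
Import Order.TTheory GRing.Theory Num.Theory.
Import numFieldNormedType.Exports.
Local Open Scope classical_set_scope.
Local Open Scope ring_scope.

(** Why the theorem holds.

    Suppose that S = xi + eta and D = (xi - eta)^2 are independent.  Since p is
    odd, 2 is a unit of Z_p, so the ultrametric inequality shows that S and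
    xi - eta lie in the balls of radius r about 2u and 2v exactly when xi and
    eta lie in the balls of radius r about u + v and u - v
    ([sum_diff_cball]).  For r < |v|, a suitable small ball about (2v)^2 pulls
    back under squaring to the two disjoint balls of radius r about 2v and -2v
    ([sqr_cball]), which contribute equally because xi and eta are exchangeable.
    Hence the ball masses M(x) = mu(B_r(x)) satisfy M(u + v) M(u - v) = F(u) c(v)
    ([ball_equation]).  Eliminating F and c, dividing by powers of the volume of
    the ball and letting r tend to 0 gives, as rho is continuous,
      rho(u+v) rho(u-v) rho(u')^2 = rho(u)^2 rho(u'+v) rho(u'-v)
    ([density_exchange]).

    Choose a with rho(a) > 0 and put f(x) = rho(a + x) / rho(a).  Then f(0) = 1
    and f(u+v) f(u-v) = f(u)^2 f(v) f(-v); with u = v this says that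
    g(u) = f(u) f(-u) satisfies g(2u) = g(u)^4, so g(2^k u) = g(u)^(4^k).  The
    powers of 2 with exponent phi(p^n) tend to 1 in Q_p, so the right-hand side
    has limit g(u) along them, which forces g(u) to be 0 or 1; the same argument
    then applies to f ([midpoint_eq_01]).  So f is the indicator of a clopen
    subgroup K ([midpoint_eq_subgroup]).  Its volume is 1 / rho(a), so K is
    covered by finitely many balls of each small radius and, Q_p being complete,
    is compact.  Therefore mu is the shift by a of the Haar distribution of K
    ([idempotent_of_exchange]).

    Conversely, let mu be the shift by a of the Haar distribution of K.  Then mu
    is invariant under translations by K.  By Fubini, shifting xi by eta - a turns
    (S, xi - eta) into (xi + 2 eta - a, xi - a); now xi - a = 2k with k in K,
    because K is 2-divisible ([compact_subgroup_half]), and 2 (eta + k) has the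
    law of 2 eta.  So S is independent of xi - eta ([sum_diff_law]), a fortiori
    of its square. *)

Set Implicit Arguments.
Unset Strict Implicit.
Unset Printing Implicit Defensive.

(** * Topology of the p-adic numbers *)

Section padic_topology.
Variables (p : nat) (p_pr : prime p).
Local Notation Qp := (padic p_pr).
Local Notation nm := (@padic_norm p p_pr).
Local Notation pi := (fun u : pcseq p_pr => \pi_({ideal_quot (pnull p_pr)})%qT u : Qp).
Implicit Types (x y z : Qp) (r : rat).

Lemma padic_norm0 : nm 0 = 0.
Proof. by apply/eqP; rewrite padic_norm_eq0. Qed.

Lemma padic_norm_nat n : (0 < n)%N -> nm n%:R = p%:R ^- logn p n.
Proof.
move=> n0; rewrite -(ratr_nat Qp n) padic_norm_ratr -[n%:R]divr1.
rewrite (@ratpnorm_frac p n%:Z 1%:Z)// -?lt0n//.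
by rewrite logn1 sub0r -exprnN.
Qed.

Lemma padic_norm1 : nm 1 = 1.
Proof. by rewrite (@padic_norm_nat 1)// logn1 expr0 invr1. Qed.

Lemma padic_normD_le x y r : nm x <= r -> nm y <= r -> nm (x + y) <= r.
Proof. by move=> xr yr; rewrite (le_trans (ler_padic_normD _ _))// ge_max xr. Qed.

Lemma padic_normB_le x y r : nm x <= r -> nm y <= r -> nm (x - y) <= r.
Proof. by move=> xr yr; rewrite padic_normD_le ?padic_normN. Qed.

Lemma padic_norm2 : (2 < p)%N -> nm 2 = 1.
Proof.
by move=> p2; rewrite padic_norm_nat// lognE p_pr/= gtnNdvd// expr0 invr1.
Qed.

Definition prad (n : nat) : rat := p%:R ^- n.

Lemma prad_gt0 n : 0 < prad n.
Proof. by rewrite invr_gt0 exprn_gt0// ltr0n prime_gt0. Qed.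

Lemma prad_le m n : (m <= n)%N -> prad n <= prad m.
Proof.
move=> mn; rewrite lef_pV2 ?posrE ?exprn_gt0 ?ltr0n ?prime_gt0//.
by rewrite ler_eXn2l// ltr1n prime_gt1.
Qed.

Lemma prad_small r : 0 < r -> exists n, prad n <= r.
Proof.
move=> r0; exists (Num.bound r^-1).
rewrite -[leRHS]invrK lef_pV2 ?posrE ?invr_gt0 ?exprn_gt0 ?ltr0n ?prime_gt0//.
have := archi_boundP (ltW (_ : 0 < r^-1)); rewrite invr_gt0 => /(_ r0)/ltW h.
by rewrite (le_trans h)// -natrX ler_nat ltnW// ltn_expl// prime_gt1.
Qed.

Lemma padic_norm_natX n : nm (p%:R ^+ n) = prad n.
Proof.
by rewrite -natrX padic_norm_nat ?expn_gt0 ?prime_gt0// pfactorK.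
Qed.

(** Closed rather than open balls, so that for the radii [prad n] they are the
    cosets of the subgroups p^n Z_p; every point of a ball is then a centre. *)
Definition cball (r : rat) (x : Qp) : set Qp := [set y | nm (y - x) <= r].

Lemma cball_center r x : 0 <= r -> cball r x x.
Proof. by move=> r0; rewrite /cball/= subrr padic_norm0. Qed.

Lemma cball_sym r x y : cball r x y -> cball r y x.
Proof. by rewrite /cball/= -padic_normN opprB. Qed.

Lemma cball_trans r y x z : cball r x y -> cball r y z -> cball r x z.
Proof.
by rewrite /cball/= => xy yz; rewrite -(subrKA y z) padic_normD_le.
Qed.

Lemma cballE r x y : cball r x y -> cball r y = cball r x.
Proof.
move=> xy; apply/seteqP; split=> z; first exact: cball_trans.
exact/cball_trans/cball_sym.
Qed.

Lemma nbhs_cball x (A : set Qp) :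
  nbhs x A <-> exists n, cball (prad n) x `<=` A.
Proof.
split.
  move=> /nbhs_ballP[r /= r0 rA].
  have r2 : 0 < r / 2 by rewrite divr_gt0.
  have [n nr] := prad_small r2; exists n => y xy; apply: rA.
  rewrite ballEmdist/= [X in X < _]padic_dist_sym (le_lt_trans xy)//.
  by rewrite (le_lt_trans nr)// ltr_pdivrMr// ltr_pMr// ltr1n.
move=> [n nA]; apply/nbhs_ballP; exists (prad n) => [/=|y]; first exact: prad_gt0.
rewrite ballEmdist/= => /ltW xy; apply: nA.
by rewrite /cball/= padic_dist_sym.
Qed.

Lemma nbhs_cballr x r : 0 < r -> nbhs x (cball r x).
Proof.
move=> /prad_small[n nr]; apply/nbhs_cball; exists n => y.
by rewrite /cball/= => /le_trans; apply.
Qed.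

Lemma cball_open r x : 0 < r -> open (cball r x).
Proof.
move=> r0; rewrite openE => y xy; rewrite /interior -(cballE xy).
exact: nbhs_cballr.
Qed.

Lemma padic_hausdorff : hausdorff_space Qp.
Proof. exact: metric_hausdorff. Qed.

Lemma continuous_padicD a : continuous (fun x : Qp => a + x).
Proof.
move=> x A /nbhs_cball[n nA]; apply/nbhs_cball; exists n => y xy.
by apply: nA; rewrite /cball/= opprD addrACA subrr add0r.
Qed.

Lemma continuous_padicM a : continuous (fun x : Qp => a * x).
Proof.
move=> x A /nbhs_cball[n nA].
have [a0|a0] := eqVneq a 0.
  apply/nbhs_cball; exists 0%N => y _; apply: nA.
  rewrite a0 !mul0r; apply: cball_center; exact/ltW/prad_gt0.
have na0 : 0 < nm a by rewrite lt_def padic_norm_eq0 a0 padic_norm_ge0.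
have /prad_small[k kn] : 0 < prad n / nm a by rewrite divr_gt0// prad_gt0.
apply/nbhs_cball; exists k => y xy; apply: nA.
rewrite /cball/= -mulrBr padic_normM mulrC -ler_pdivlMr//.
exact: le_trans xy kn.
Qed.

Lemma continuous_padic_sqr : continuous (fun x : Qp => x ^+ 2).
Proof.
move=> x A /nbhs_cball[n nA].
have m0 : 0 < Num.max 1 (nm x) by rewrite lt_max ltr01.
have /prad_small[k kn] : 0 < prad n / Num.max 1 (nm x) by rewrite divr_gt0// prad_gt0.
apply/nbhs_cball; exists k => y xy; apply: nA.
rewrite /cball/= subr_sqr padic_normM.
have xym : nm (y + x) <= Num.max 1 (nm x).
  apply: padic_normD_le; last by rewrite le_max lexx orbT.
  rewrite -[y](subrK x).
  rewrite (le_trans (ler_padic_normD _ _))// ge_max !le_max lexx orbT andbT.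
  by rewrite (le_trans xy)// -[leRHS]invr1 -(expr0 p%:R) (@prad_le 0).
rewrite (le_trans (ler_pM _ _ (le_trans xy kn) xym)) ?padic_norm_ge0//.
by rewrite divfK// gt_eqF.
Qed.

Let pconst_cauchy (q : rat) : (fun=> q) \in pcauchy p_pr.
Proof. by apply/asboolP => e e0; exists 0%N => m n _ _; rewrite subrr ratpnorm0. Qed.

(** The canonical image of a rational, as the class of a constant sequence:
    distances to such points can be read off the defining Cauchy sequences. *)
Definition padic_rat (q : rat) : Qp := pi (PCSeq (pconst_cauchy q)).

Lemma padic_norm_le_ev (u : pcseq p_pr) r :
  (exists N, forall n, (N <= n)%N -> ratpnorm p (u n) <= r) -> nm (pi u) <= r.
Proof.
move=> [N uN]; have /rat_cvgP h := @padic_norm_cvg p p_pr u.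
apply/ler_addgt0Pr => e /h[M hM].
have := hM _ (leq_maxr N M); have := uN _ (leq_maxl N M).
rewrite ltr_distl => ur /andP[h' _].
by rewrite -lerBlDr (le_trans (ltW h')).
Qed.

Lemma padic_rat_dense x r : 0 < r -> exists q, cball r x (padic_rat q).
Proof.
move=> r0; have /asboolP/(_ r r0)[N uN] := pcseqP (repr x).
exists (repr x N); apply: cball_sym.
rewrite /cball/= -{1}[x]reprK -rmorphB; apply: padic_norm_le_ev.
by exists N => n Nn; exact/ltW/uN.
Qed.

Lemma padic_rat_normB (q r : rat) :
  nm (padic_rat q - padic_rat r) = ratpnorm p (q - r).
Proof.
rewrite /padic_rat -rmorphB; apply: rat_cvg_unique (@padic_norm_cvg p p_pr _) _.
by apply/rat_cvgP => e e0; exists 0%N => n _; rewrite subrr normr0.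
Qed.

(** The approximations are taken rational because a Cauchy sequence of rationals
    is itself a representative of its limit. *)
Lemma padic_complete (q : nat -> rat) :
  (forall m n, (m <= n)%N -> nm (padic_rat (q n) - padic_rat (q m)) <= prad m) ->
  exists x, forall n, cball (prad n) x (padic_rat (q n)).
Proof.
move=> qC; have qP : q \in pcauchy p_pr.
  apply/asboolP => e e0; have [N Ne] := prad_small (divr_gt0 e0 (ltr0n _ 2)).
  have e2e : e / 2 < e by rewrite ltr_pdivrMr// ltr_pMr// ltr1n.
  exists N => m n Nm Nn; rewrite -padic_rat_normB (le_lt_trans _ e2e)//.
  rewrite (le_trans _ Ne)// -(subrKA (padic_rat (q N))).
  by rewrite padic_normD_le ?qC// padic_dist_sym qC.
exists (pi (PCSeq qP)) => n; apply: cball_sym.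
rewrite /cball/= /padic_rat -rmorphB; apply: padic_norm_le_ev.
by exists n => k nk; rewrite -[leLHS]padic_rat_normB; exact: qC.
Qed.

End padic_topology.

(** * Compactness, Borel sets and volumes *)

Section padic_compact.
Variables (p : nat) (p_pr : prime p).
Local Notation Qp := (padic p_pr).
Implicit Types (x y z : Qp) (r : rat) (A K : set Qp) (s : seq Qp).

Lemma ultra_cball (F : set_system Qp) r s K : UltraFilter F -> F K ->
  (forall y, K y -> exists2 x, x \in s & cball r x y) ->
  exists x, F (cball r x).
Proof.
move=> UF; elim: s K => [|x s ih] K FK Ks.
  by have [y /Ks[]] := filter_ex FK.
have [Fx|FNx] := in_ultra_setVsetC (cball r x) UF; first by exists x.
apply: (ih (K `&` ~` cball r x)) => [|y [/Ks[z]]]; first exact: filterI.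
rewrite inE => /orP[/eqP -> //|zs zy _]; by exists z.
Qed.

(** Total boundedness and completeness give compactness: an ultrafilter on [K]
    chooses one ball of each radius, and rational points near the centres of
    these nested balls form a Cauchy sequence. *)
Lemma padic_compact K : closed K ->
  (forall n, exists s, forall y, K y -> exists2 x, x \in s & cball (prad p n) x y) ->
  compact K.
Proof.
move=> Kcl Kcov; rewrite compact_ultra => F UF FK.
have /choice[q Fq] n : exists q, F (cball (prad p n) (padic_rat p_pr q)).
  have [s /(ultra_cball UF FK)[x Fx]] := Kcov n.
  have [q xq] := padic_rat_dense x (prad_gt0 p_pr n).
  by exists q; rewrite (cballE xq).
have [|x xq] := @padic_complete p p_pr q.
  move=> m n mn; have [y [ym yn]] := filter_ex (filterI (Fq m) (Fq n)).
  apply: (cball_trans ym); apply: cball_sym.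
  exact: le_trans yn (prad_le p_pr mn).
have Fx : F --> x.
  move=> A /nbhs_cball[n nA]; apply: filterS nA _.
  by rewrite -(cballE (xq n)); exact: Fq.
exists x; split=> //; apply: Kcl => A /Fx FA.
exact: filter_ex (filterI FK FA).
Qed.

End padic_compact.

Section padic_measurable.
Variables (p : nat) (p_pr : prime p).
Local Notation Qp := (padic p_pr).
Implicit Types (A B U : set Qp).

Lemma open_measurable_padic U : open U -> measurable U.
Proof. exact: sub_sigma_algebra. Qed.

Lemma closed_measurable_padic A : closed A -> measurable A.
Proof.
move=> Acl; rewrite -[A]setCK; apply: measurableC.
by apply: open_measurable_padic; exact: closed_openC.
Qed.

Lemma cball_measurable (r : rat) (x : Qp) : 0 < r -> measurable (cball r x).
Proof. by move=> r0; apply: open_measurable_padic; exact: cball_open. Qed.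

Lemma measurable_fun_padic d (T : measurableType d) (f : T -> Qp) :
  (forall U, open U -> measurable (f @^-1` U)) -> measurable_fun setT f.
Proof.
move=> fU; apply: (measurability (@open Qp)) => // _ [U oU <-].
by rewrite setTI; exact: fU.
Qed.

Lemma measurable_fun_continuous_padic (f : Qp -> Qp) :
  continuous f -> measurable_fun setT f.
Proof.
move=> fc; apply: measurable_fun_padic => U oU; apply: open_measurable_padic.
by apply: open_comp => // x _; exact: fc.
Qed.

(** Q_p is second countable: the condition that a sum lies in an open set is a
    countable union of conditions on the balls that contain the summands. *)
Lemma measurable_fun_padicD d (T : measurableType d) (f g : T -> Qp) :
  measurable_fun setT f -> measurable_fun setT g ->
  measurable_fun setT (fun w => f w + g w).
Proof.
move=> mf mg; apply: measurable_fun_padic => U oU.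
pose c (i : nat * rat * rat) : set T :=
  if `[< cball (prad p i.1.1) (padic_rat p_pr i.1.2 + padic_rat p_pr i.2) `<=` U >]
  then f @^-1` cball (prad p i.1.1) (padic_rat p_pr i.1.2) `&`
       g @^-1` cball (prad p i.1.1) (padic_rat p_pr i.2)
  else set0.
have -> : (fun w => f w + g w) @^-1` U = \bigcup_i c i.
  apply/seteqP; split=> [w /= Uw|w [[[n q] q'] _]].
    have /nbhs_cball[n nU] := open_nbhs_nbhs (conj oU Uw).
    have [q fq] := padic_rat_dense (f w) (prad_gt0 p_pr n).
    have [q' gq] := padic_rat_dense (g w) (prad_gt0 p_pr n).
    exists (n, q, q') => //; rewrite /c/=; case: asboolP => [_|]; last first.
      rewrite (@cballE _ _ _ (f w + g w))//.
      by rewrite /cball/= opprD addrACA padic_normD_le.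
    by split; exact: cball_sym.
  rewrite /c/=; case: asboolP => // nU [/= fq gq]; apply: nU.
  by rewrite /cball/= opprD addrACA padic_normD_le.
apply: countable_bigcupT_measurable => [|i]; first exact: countableP.
rewrite /c; case: asboolP => // _; have r0 := prad_gt0 p_pr i.1.1.
apply: measurableI; rewrite -[X in measurable X]setTI.
  by apply: mf => //; exact: cball_measurable.
by apply: mg => //; exact: cball_measurable.
Qed.

Lemma measurable_fun_padicB d (T : measurableType d) (f g : T -> Qp) :
  measurable_fun setT f -> measurable_fun setT g ->
  measurable_fun setT (fun w => f w - g w).
Proof.
move=> mf mg; under eq_fun do rewrite -mulN1r.
apply: measurable_fun_padicD => //.
apply: (measurableT_comp (measurable_fun_continuous_padic (@continuous_padicM _ _ _))).
exact: mg.
Qed.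

End padic_measurable.

Section haar.
Variables (p : nat) (p_pr : prime p) (R : realType).
Local Notation Qp := (padic p_pr).
Variable m : {measure set Qp -> \bar R}.
Hypothesis m_haar : padic_haar_measure m.
Local Open Scope ereal_scope.

Lemma translate_preimage (a : Qp) (A : set Qp) :
  [set (a + x)%R | x in A] = (fun x => - a + x)%R @^-1` A.
Proof.
apply/seteqP; split=> [_ [x Ax <-]/=|x Ax]; first by rewrite addKr.
by exists (- a + x)%R => //; rewrite addNKr.
Qed.

Lemma translate_measurable (a : Qp) (A : set Qp) :
  measurable A -> measurable [set (a + x)%R | x in A].
Proof.
move=> mA; rewrite translate_preimage -[X in measurable X]setTI.
exact: (measurable_fun_continuous_padic (@continuous_padicD _ _ _)).
Qed.

Lemma haar_cball (r : rat) (x : Qp) : (0 < r)%R -> m (cball r x) = m (cball r 0%R).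
Proof.
move=> r0; rewrite -(m_haar.2 x (cball r 0%R)); last exact: cball_measurable.
by rewrite translate_preimage; congr (m _); apply/seteqP; split=> y;
  rewrite /cball/= subr0 addrC.
Qed.

Let padic_intE : @padic_int p p_pr = cball 1 0%R.
Proof. by apply/seteqP; split=> y; rewrite /padic_int /cball/= subr0. Qed.

Lemma haar_cball_le1 n (x : Qp) : m (cball (prad p n) x) <= 1.
Proof.
rewrite haar_cball ?prad_gt0// -m_haar.1.
apply: le_measure; rewrite ?inE ?padic_intE; [by apply: cball_measurable; exact: prad_gt0|exact: cball_measurable|].
move=> y /le_trans; apply; rewrite -[leRHS]/(1%R).
by rewrite -[leRHS]invr1 -(expr0 p%:R) (@prad_le _ _ 0).
Qed.

(** Otherwise Q_p, a countable union of translates of a null ball, would be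
    null. *)
Lemma haar_cball_gt0 (r : rat) (x : Qp) : (0 < r)%R -> 0 < m (cball r x).
Proof.
move=> r0; rewrite haar_cball// lt_def measure_ge0 andbT; apply/eqP => m0.
have /negligibleP : m.-negligible (\bigcup_(n : nat)
    cball r (padic_rat p_pr (odflt 0%R (unpickle n)))).
  apply: negligible_bigcup => n; apply/negligibleP; first exact: cball_measurable.
  exact: etrans (haar_cball _ r0) m0.
have -> : \bigcup_(n : nat) cball r (padic_rat p_pr (odflt 0%R (unpickle n))) = setT.
  apply/seteqP; split=> // y _; have [q yq] := padic_rat_dense y r0.
  by exists (pickle q) => //; rewrite pickleK; exact: cball_sym.
move=> /(_ measurableT) mT; have := m_haar.1.
have : m (@padic_int p p_pr) <= m setT.
  by apply: le_measure; rewrite ?inE ?padic_intE//; exact: cball_measurable.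
by move=> + m1; rewrite m1 mT lee_fin ler10.
Qed.

(** Disjoint balls of one radius have the same positive volume, so a set of
    finite volume holds boundedly many of them, and a maximal family covers.
    In particular finiteness of the volume replaces boundedness. *)
Lemma haar_finite_cover n (A : set Qp) : measurable A -> m A < +oo ->
  (forall x, A x -> cball (prad p n) x `<=` A) ->
  exists s : seq Qp, forall y, A y -> exists2 x, x \in s & cball (prad p n) x y.
Proof.
move=> mA Afin Acl; absurd_not => nocov.
pose r := prad p n; have r0 : (0 < r)%R := prad_gt0 p_pr n.
pose V := fine (m (cball r (0 : Qp)%R)).
have VE (x : Qp) : m (cball r x) = V%:E.
  rewrite haar_cball// /V fineK// ge0_fin_numE ?measure_ge0//.
  by rewrite (le_lt_trans (haar_cball_le1 _ _))// ltry.
have V0 : (0 < V)%R by rewrite -lte_fin -(VE 0%R) haar_cball_gt0.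
have key k : exists s : seq Qp, exists U : set Qp,
  [/\ measurable U, U `<=` A, forall y, U y -> exists2 x, x \in s & cball r x y &
      m U = (k%:R * V)%:E].
  (* U is the union of the balls centred in s, kept abstract: only its measure
     and the fact that s covers it matter. *)
  elim: k => [|k [s [U [mU UA Us mE]]]].
    by exists [::], set0; split=> //; rewrite measure0 mul0r.
  have [x Ax xs] := nocov s.
  exists (x :: s), (U `|` cball r x); split.
  - by apply: measurableU => //; exact: cball_measurable.
  - by move=> y [/UA//|]; exact: Acl.
  - move=> y [/Us[z zs zy]|xy]; last by exists x; rewrite ?mem_head.
    by exists z; rewrite // inE zs orbT.
  - rewrite measureU//; last 2 first.
    + exact: cball_measurable.
    + rewrite -subset0 => y [/Us[z zs zy] xy]; have /negP := xs _ zs; apply.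
      exact: cball_trans zy (cball_sym xy).
    rewrite -natr1 mulrDl mul1r EFinD; congr (_ + _); [exact: mE|exact: VE].
have Afine : m A = (fine (m A))%:E.
  by rewrite fineK// ge0_fin_numE ?measure_ge0.
pose k := Num.bound (fine (m A) / V)%R.
have [s [U [mU UA _ mE]]] := key k.
have : m U <= m A by apply: le_measure; rewrite ?inE.
rewrite mE Afine lee_fin leNgt -ltr_pdivrMr//.
by rewrite archi_boundP// divr_ge0 ?fine_ge0 ?measure_ge0// ltW.
Qed.
End haar.

(** * A multiplicative functional equation *)

Section iterated_power.
Variable R : realType.

(** For 0 < y < 1 the powers stay below y^2 < y, and for y > 1 above y^2 > y, so
    they cannot tend to y. *)
Lemma pow_limit_01 (y : R) (e : nat -> nat) : 0 <= y -> (forall n, (1 < e n)%N) ->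
  y ^+ e n @[n --> \oo] --> y -> y = 0 \/ y = 1.
Proof.
move=> y0 e2 ye; have [y1|y1|] := ltgtP y 1; last by right.
  left; have : y <= y ^+ 2.
    apply: (cvgr_to_le ye); apply: nearW => n.
    by apply: ler_wiXn2l => //; rewrite ?ltW// y0 ltW.
  rewrite expr2 => h; apply/eqP; rewrite eq_le y0 andbT leNgt; apply/negP => y_gt0.
  by move: h; rewrite leNgt gtr_pMl ?y1.
have : y ^+ 2 <= y.
  apply: (cvgr_to_ge ye); apply: nearW => n.
  by apply: ler_weXn2l => //; exact: ltW.
by rewrite expr2 leNgt ltr_pMl ?y1// (lt_trans _ y1).
Qed.
End iterated_power.

Section functional_equation.
Variables (p : nat) (p_pr : prime p) (R : realType).
Hypothesis p_gt2 : (2 < p)%N.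
Local Notation Qp := (padic p_pr).
Local Notation nm := (@padic_norm p p_pr).

(** By Euler's theorem 2 to this power is 1 modulo p^(n+1), so these powers of 2
    tend to 1 in Q_p: a substitute for the periodicity of doubling in a finite
    group of odd order. *)
Definition exp2 (n : nat) : nat := totient (p ^ n.+1).

Lemma exp2_gt0 n : (0 < exp2 n)%N.
Proof. by rewrite totient_gt0 expn_gt0 prime_gt0. Qed.

Lemma cvg_exp2 (x : Qp) : 2 ^+ exp2 n * x @[n --> \oo] --> x.
Proof.
move=> A /nbhs_cball[k kA].
have nx1 : 0 < 1 + nm x by rewrite ltr_wpDr ?padic_norm_ge0.
have /(prad_small p_pr)[j jk] : 0 < prad p k / (1 + nm x) by rewrite divr_gt0 ?prad_gt0.
exists j => // n /= jn; apply: kA; rewrite /cball/=.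
have /eqP : 2 ^ exp2 n = 1 %[mod p ^ n.+1].
  rewrite Euler_exp_totient// coprime_sym coprimeXl// prime_coprime//.
  by rewrite gtnNdvd.
rewrite eqn_mod_dvd ?expn_gt0// => /dvdnP[q E].
have -> : (2 : Qp) ^+ exp2 n * x - x = (q%:R * x) * p%:R ^+ n.+1.
  rewrite -[X in _ - X]mul1r -mulrBl [RHS]mulrAC -!natrX -natrM -E natrB ?expn_gt0//.
rewrite !padic_normM padic_norm_natX.
have q1 : nm q%:R <= 1.
  have [->|q0] := posnP q; first by rewrite padic_norm0.
  by rewrite padic_norm_nat// -[leRHS]invr1 -(expr0 p%:R) (@prad_le _ _ 0).
have jn1 : prad p n.+1 <= prad p k / (1 + nm x).
  by rewrite (le_trans _ jk)// prad_le// (leq_trans jn).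
rewrite (le_trans (ler_pM _ _ (ler_piMl _ q1) jn1)) ?mulr_ge0 ?padic_norm_ge0//.
  exact/ltW/prad_gt0.
rewrite mulrC -mulrA ler_piMr ?(ltW (prad_gt0 _ _))// mulrC.
by rewrite ler_pdivrMr// mul1r lerDr.
Qed.

Variable f : Qp -> R.
Hypotheses (f_cont : continuous f) (f_ge0 : forall x, 0 <= f x) (f0 : f 0 = 1).
Hypothesis fE : forall u v, f (u + v) * f (u - v) = f u ^+ 2 * (f v * f (- v)).

Let g u := f u * f (- u).

Let f_dbl u : f (2 * u) = f u ^+ 2 * g u.
Proof. by have := fE u u; rewrite subrr f0 mulr1 mulr2n mulrDl mul1r. Qed.

Let gN u : g (- u) = g u.
Proof. by rewrite /g opprK mulrC. Qed.

Let g_dbl u : g (2 * u) = g u ^+ 4.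
Proof. rewrite {1}/g -mulrN !f_dbl gN /g; ring. Qed.

Let g_iter u k : g (2 ^+ k * u) = g u ^+ (4 ^ k).
Proof.
elim: k => [|k ih]; first by rewrite expr0 mul1r expn0 expr1.
by rewrite exprS -mulrA g_dbl ih -exprM expnSr.
Qed.

Let f_cvg u : f (2 ^+ exp2 n * u) @[n --> \oo] --> f u.
Proof. exact: cvg_comp (@cvg_exp2 u) (@f_cont u). Qed.

Let g_01 u : g u = 0 \/ g u = 1.
Proof.
apply: (@pow_limit_01 _ _ (fun n => 4 ^ exp2 n)%N).
- by rewrite mulr_ge0.
- by move=> n; rewrite -{1}(expn0 4) ltn_exp2l// exp2_gt0.
- under eq_fun do rewrite -g_iter /g -mulrN.
  by apply: cvgM; exact: f_cvg.
Qed.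

(** The equation with u = v reads f(2u) = f(u)^2 g(u), where g(u) = f(u) f(-u) is
    0 or 1.  If g(u) = 0 then f vanishes at every 2^k u with k > 0, hence at their
    limit point u; if g(u) = 1 then f(2^k u) = f(u)^(2^k), and f(u) is a limit of
    powers of itself. *)
Lemma midpoint_eq_01 u : f u = 0 \/ f u = 1 /\ f (- u) = 1.
Proof.
have [gu|gu] := g_01 u.
  left; apply: (cvg_unique _ (@f_cvg u)); first exact: norm_hausdorff.
  have -> : (fun n => f (2 ^+ exp2 n * u)) = cst 0; last exact: cvg_cst.
  apply/funext => n; rewrite -(prednK (exp2_gt0 n)) exprS -mulrA f_dbl.
  by rewrite g_iter gu expr0n/= expn_eq0/= mulr0.
right; have fi k : f (2 ^+ k * u) = f u ^+ (2 ^ k).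
  elim: k => [|k ih]; first by rewrite expr0 mul1r expn0 expr1.
  by rewrite exprS -mulrA f_dbl g_iter gu expr1n mulr1 ih -exprM expnSr.
have fu : f u = 1.
  have [||fu|//] := @pow_limit_01 _ (f u) (fun n => 2 ^ exp2 n)%N (f_ge0 u).
  - by move=> n; rewrite -{1}(expn0 2) ltn_exp2l// exp2_gt0.
  - by under eq_fun do rewrite -fi; exact: f_cvg.
  - by move: gu => /eqP; rewrite /g fu mul0r eq_sym oner_eq0.
by split=> //; move: gu; rewrite /g fu mul1r.
Qed.

(** When f(u) = f(v) = f(-v) = 1 the equation makes f(u+v) f(u-v) equal to 1, so
    f(u-v) cannot vanish. *)
Lemma midpoint_eq_subgroup u v : f u = 1 -> f v = 1 -> f (u - v) = 1.
Proof.
move=> fu fv; have [/eqP|[_ fNv]] := midpoint_eq_01 v; first by rewrite fv oner_eq0.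
have [h|[]//] := midpoint_eq_01 (u - v).
by have /eqP := fE u v; rewrite h fu fv fNv mulr0 expr1n !mulr1 eq_sym oner_eq0.
Qed.

End functional_equation.

(** * Squares, sums and differences of balls *)

Section odd_balls.
Variables (p : nat) (p_pr : prime p).
Hypothesis p_gt2 : (2 < p)%N.
Local Notation Qp := (padic p_pr).
Local Notation nm := (@padic_norm p p_pr).
Implicit Types (x y z u v : Qp) (r : rat).

Lemma padic_norm_dbl x : nm (2 * x) = nm x.
Proof. by rewrite padic_normM padic_norm2// mul1r. Qed.

(** The linear map (x, y) -> (x + y, x - y) has determinant -2, a unit of Z_p, so
    it maps products of balls of radius r onto such products. *)
Lemma sum_diff_cball r u v x y :
  cball r (2 * u) (x + y) /\ cball r (2 * v) (x - y) <->
  cball r (u + v) x /\ cball r (u - v) y.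
Proof.
rewrite /cball/=; split=> -[h1 h2]; split.
- rewrite -padic_norm_dbl (_ : 2 * _ = (x + y - 2 * u) + (x - y - 2 * v)).
    exact: padic_normD_le.
  by ring.
- rewrite -padic_norm_dbl (_ : 2 * _ = (x + y - 2 * u) - (x - y - 2 * v)).
    exact: padic_normB_le.
  by ring.
- rewrite (_ : x + y - _ = (x - (u + v)) + (y - (u - v))); last by ring.
  exact: padic_normD_le.
- rewrite (_ : x - y - _ = (x - (u + v)) - (y - (u - v))); last by ring.
  exact: padic_normB_le.
Qed.

Lemma cball_opp_disjoint r w t : r < nm w -> cball r w t -> ~ cball r (- w) t.
Proof.
move=> rw h1 h2; have : nm (2 * w) <= r.
  rewrite (_ : 2 * w = (t - - w) - (t - w)); last by ring.
  exact: padic_normB_le.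
by rewrite padic_norm_dbl leNgt rw.
Qed.

(** If t^2 is within r |w| of w^2, one of t - w and t + w has norm less than |w|;
    the other then has norm exactly |w|, as 2w has norm |w|, and the first has
    norm at most r. *)
Lemma sqr_cball r w t : 0 <= r -> r < nm w ->
  cball (r * nm w) (w ^+ 2) (t ^+ 2) <-> cball r w t \/ cball r (- w) t.
Proof.
move=> r0 rw; have w0 := le_lt_trans r0 rw.
have aux (s : Qp) : nm (s ^+ 2 - w ^+ 2) <= r * nm w -> nm (s - w) < nm w -> nm (s - w) <= r.
  move=> h sw; suff sw' : nm w <= nm (s + w).
    rewrite -(ler_pM2r w0) (le_trans _ h)// subr_sqr padic_normM.
    by rewrite ler_wpM2l ?padic_norm_ge0.
  rewrite leNgt; apply/negP => sw'.
  have : nm (2 * w) <= Num.max (nm (s + w)) (nm (s - w)).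
    rewrite (_ : 2 * w = (s + w) + - (s - w)); last by ring.
    by rewrite (le_trans (ler_padic_normD _ _))// padic_normN.
  by rewrite padic_norm_dbl leNgt gt_max sw sw'.
rewrite /cball/=; split.
  move=> h; have [tw|tw] := ltP (nm (t - w)) (nm w); first by left; exact: aux.
  right; have h' : nm ((- t) ^+ 2 - w ^+ 2) <= r * nm w by rewrite sqrrN.
  have : nm (- t - w) <= r; last by rewrite -opprD padic_normN opprK.
  apply: aux => //.
  rewrite ltNge; apply/negP => tw'.
  have : nm w * nm w <= r * nm w.
    rewrite (le_trans _ h)// subr_sqr padic_normM; apply: ler_pM; rewrite ?padic_norm_ge0//.
    by rewrite -(padic_normN (t + w)) opprD.
  by rewrite ler_pM2r// leNgt rw.
have h t' : nm (t' - w) <= r -> nm (t' ^+ 2 - w ^+ 2) <= r * nm w.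
  move=> tw; rewrite subr_sqr padic_normM; apply: ler_pM; rewrite ?padic_norm_ge0//.
  rewrite (_ : t' + w = (t' - w) + 2 * w); last by ring.
  by rewrite padic_normD_le ?padic_norm_dbl// ltW// (le_lt_trans tw).
case=> tw; first exact: h.
by rewrite -sqrrN; apply: h; rewrite -opprD padic_normN -{1}(opprK w).
Qed.

Lemma sqr_cball0 r t : 0 <= r -> cball (r ^+ 2) (0 : Qp) (t ^+ 2) <-> cball r (0 : Qp) t.
Proof.
move=> r0; rewrite /cball/= !subr0 expr2 padic_normM -expr2.
by rewrite ler_pXn2r// nnegrE ?padic_norm_ge0.
Qed.

End odd_balls.

Section ball_equation.
Variables (p : nat) (p_pr : prime p) (p_gt2 : (2 < p)%N).
Local Notation Qp := (padic p_pr).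
Local Notation nm := (@padic_norm p p_pr).
Variables (R : realType) (d : measure_display) (T : measurableType d)
  (P : probability T R) (xi eta : {RV P >-> Qp}) (mu : probability Qp R).
Hypotheses (xi_eta_indep : independent_rv P xi eta)
  (xi_mu : has_distribution xi mu) (eta_mu : has_distribution eta mu).
Hypothesis SD : independent_rv P (fun w : T => xi w + eta w)
                   (fun w : T => (xi w - eta w) ^+ 2).
Local Open Scope ereal_scope.

Let M (r : rat) (x : Qp) : R := fine (mu (cball r x)).

Let pair_cball (r : rat) (u v : Qp) : (0 < r)%R ->
  P ((fun w => xi w + eta w)%R @^-1` cball r (2 * u)%R `&`
     (fun w => xi w - eta w)%R @^-1` cball r (2 * v)%R) =
  (M r (u + v)%R * M r (u - v)%R)%:E.
Proof.
move=> r0; rewrite (_ : _ `&` _ = xi @^-1` cball r (u + v)%R `&` eta @^-1` cball r (u - v)%R).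
  rewrite xi_eta_indep; [|exact: cball_measurable..].
  rewrite EFinM /M !fineK ?fin_num_measure//; [|exact: cball_measurable..].
  by congr (_ * _); [apply: xi_mu|apply: eta_mu]; exact: cball_measurable.
apply/seteqP; split=> w /=; first by move/(sum_diff_cball p_gt2).
by move/(sum_diff_cball p_gt2).
Qed.

Let PE (A : set T) : measurable A -> (fine (P A))%:E = P A.
Proof. by move=> mA; rewrite fineK// fin_num_measure. Qed.

(** The left-hand side is the probability that S and xi - eta lie in given balls,
    and the right-hand side is what independence of S and D makes of it.  For
    v != 0 the preimage of a ball under squaring consists of two balls, whose
    contributions agree by symmetry; for v = 0 it is a single ball. *)
Lemma ball_equation (r : rat) (v : Qp) : (0 < r)%R -> ((v != 0)%R -> (r < nm v)%R) ->
  exists c : R, forall u, (M r (u + v) * M r (u - v))%R =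
    (fine (P ((fun w => xi w + eta w)%R @^-1` cball r (2 * u)%R)) * c)%R.
Proof.
move=> r0 rv.
have mS (B : set Qp) : measurable B -> measurable ((fun w => xi w + eta w)%R @^-1` B).
  move=> mB; rewrite -[X in measurable X]setTI.
  by apply: (measurable_fun_padicD _ _) => //; exact: measurable_funPT.
have mt (B : set Qp) : measurable B -> measurable ((fun w => xi w - eta w)%R @^-1` B).
  move=> mB; rewrite -[X in measurable X]setTI.
  by apply: (measurable_fun_padicB _ _) => //; exact: measurable_funPT.
have mB (x : Qp) s : (0 < s)%R -> measurable (cball s x) := @cball_measurable _ _ s x.
have [v0|v0] := eqVneq v 0%R.
  exists (fine (P ((fun w => (xi w - eta w) ^+ 2)%R @^-1` cball (r ^+ 2) 0%R))) => u.
  apply: EFin_inj; rewrite -pair_cball// EFinM !PE.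
  - rewrite -SD//; last by apply: mB; rewrite exprn_gt0.
    congr (P (_ `&` _)); apply/seteqP; split=> w /=; rewrite v0 mulr0.
      by move/(sqr_cball0 _ (ltW r0)).
    by move/(sqr_cball0 _ (ltW r0)).
  - exact: mB.
  - rewrite (_ : _ @^-1` _ = (fun w => xi w - eta w)%R @^-1` cball r (0%R : Qp)); first by apply: mt; exact: mB.
    by apply/seteqP; split=> w /(sqr_cball0 _ (ltW r0)).
  - by apply: mS; exact: mB.
have rw : (r < nm (2 * v))%R by rewrite padic_norm_dbl// rv.
pose D := (fun w => (xi w - eta w) ^+ 2)%R @^-1` cball (r * nm (2 * v))%R ((2 * v) ^+ 2)%R.
exists (fine (P D) / 2)%R => u.
have DE : D = (fun w => xi w - eta w)%R @^-1` cball r (2 * v)%R `|`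
              (fun w => xi w - eta w)%R @^-1` cball r (2 * - v)%R.
  apply/seteqP; split=> w; rewrite mulrN; first by move/(sqr_cball p_gt2 _ (ltW r0) rw).
  by move=> h; apply/(sqr_cball p_gt2 _ (ltW r0) rw).
have mD : measurable D by rewrite DE; apply: measurableU; by apply: mt; exact: mB.
apply: (@mulIf _ 2%R) => //; rewrite -[RHS]mulrA divfK//.
apply: EFin_inj; rewrite EFinM [in RHS]EFinM !PE//; last by apply: mS; exact: mB.
rewrite -SD//; [|exact: mB|by apply: mB; rewrite mulr_gt0// (lt_trans r0)].
rewrite -/D DE setIUr measureU.
- transitivity ((M r (u + v) * M r (u - v))%:E + (M r (u - v) * M r (u - - v))%:E)%R.
    by rewrite opprK [(M _ (u - v) * _)%R]mulrC -EFinD -EFinM mulr_natr mulr2n.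
  by congr (_ + _); apply/esym; exact: pair_cball.
- by apply: measurableI; [by apply: mS; exact: mB|by apply: mt; exact: mB].
- by apply: measurableI; [by apply: mS; exact: mB|by apply: mt; exact: mB].
- rewrite -subset0 => w [[_ h1] [_]] /=; rewrite mulrN.
  exact: cball_opp_disjoint h1.
Qed.

(** The two unknown factors of [ball_equation] are eliminated by comparing it with
    its instance at v = 0, so that only ball masses remain. *)
Lemma ball_exchange (r : rat) (u u' v : Qp) : (0 < r)%R -> ((v != 0)%R -> (r < nm v)%R) ->
  (M r (u + v) * M r (u - v) * M r u' ^+ 2 = M r u ^+ 2 * (M r (u' + v) * M r (u' - v)))%R.
Proof.
move=> r0 rv; have [c cE] := ball_equation r0 rv.
have [|c0 c0E] := @ball_equation r 0%R r0; first by rewrite eqxx.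
have h x : (M r x ^+ 2 = fine (P ((fun w => xi w + eta w)%R @^-1` cball r (2 * x)%R)) * c0)%R.
  by rewrite -c0E addr0 subr0 expr2.
by rewrite !cE !h; ring.
Qed.

End ball_equation.

(** * From ball masses to the density *)

Section density.
Variables (p : nat) (p_pr : prime p) (R : realType).
Local Notation Qp := (padic p_pr).
Variables (m : {measure set Qp -> \bar R}) (mu : probability Qp R) (rho : Qp -> R).
Hypotheses (m_haar : padic_haar_measure m) (mu_rho : has_density m mu rho)
  (rho_cont : continuous rho).

Lemma continuous_padic_measurable (f : Qp -> R) : continuous f -> measurable_fun setT f.
Proof.
move=> fc; apply: (measurability _ (RGenOInfty.measurableE R)) => _ [_ [x ->] <-].
rewrite setTI; apply: open_measurable_padic.
by apply: open_comp => [y _|]; [exact: fc|exact: interval_open].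
Qed.

Let rho_meas : measurable_fun setT rho := continuous_padic_measurable rho_cont.

Let vol (n : nat) : R := fine (m (cball (prad p n) (0 : Qp))).

Let haar_ball n (x : Qp) : m (cball (prad p n) x) = (vol n)%:E.
Proof.
rewrite (haar_cball m_haar) ?prad_gt0// /vol fineK// ge0_fin_numE ?measure_ge0//.
by rewrite (le_lt_trans (haar_cball_le1 m_haar _ _))// ltry.
Qed.

Let vol_gt0 n : 0 < vol n.
Proof. by rewrite -lte_fin -(haar_ball n 0) haar_cball_gt0// prad_gt0. Qed.

Let avg (n : nat) (x : Qp) : R := fine (mu (cball (prad p n) x)) / vol n.

Lemma density_ball_cvg (x : Qp) : avg n x @[n --> \oo] --> rho x.
Proof.
apply/cvgrPdist_le => e e0.
have : nbhs x (rho @^-1` [set z | `|rho x - z| <= e]).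
  by have /cvgrPdist_le/(_ e e0) := @rho_cont x.
move=> /nbhs_cball[N Ne]; exists N => // n /= Nn.
set B := cball (prad p n) x.
have mB : measurable B by apply: cball_measurable; exact: prad_gt0.
have Be y : B y -> `|rho x - rho y| <= e.
  by move=> By; apply: Ne; exact: le_trans By (prad_le p_pr Nn).
have muB : mu B = (fine (mu B))%:E by rewrite fineK// fin_num_measure.
have mrB : measurable_fun B (EFin \o rho).
  by apply/measurable_EFinP; exact: measurable_funTS.
have rho0 := mu_rho.1.
have up : fine (mu B) <= (rho x + e) * vol n.
  rewrite -lee_fin -muB mu_rho.2// EFinM -(haar_ball n x) -/B -integral_cst//.
  apply: ge0_le_integral => //.
  - by move=> y _; rewrite lee_fin.
  - by move=> y /Be; rewrite ler_norml lee_fin => /andP[h _]; lra.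
have low : rho x * vol n <= fine (mu B) + e * vol n.
  rewrite -lee_fin EFinD -muB mu_rho.2// !EFinM -(haar_ball n x) -/B -!integral_cst//.
  rewrite -ge0_integralD//; last 2 first.
  - by move=> y _; rewrite lee_fin.
  - by move=> y _; rewrite lee_fin ltW.
  apply: ge0_le_integral => //.
  - by move=> y _; rewrite lee_fin.
  - by apply: emeasurable_funD.
  - by move=> y /Be; rewrite ler_norml => /andP[_ h]; rewrite /= -EFinD lee_fin; lra.
rewrite /avg -/B ler_norml; apply/andP; split.
  by rewrite lerNl opprB lerBlDr ler_pdivrMr// addrC.
by rewrite lerBlDr -lerBlDl ler_pdivlMr// mulrBl lerBlDr.
Qed.

Hypothesis exchange : forall (r : rat) (u u' v : Qp), 0 < r -> (v != 0 -> r < padic_norm v) ->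
  fine (mu (cball r (u + v))) * fine (mu (cball r (u - v))) * fine (mu (cball r u')) ^+ 2 =
  fine (mu (cball r u)) ^+ 2 *
    (fine (mu (cball r (u' + v))) * fine (mu (cball r (u' - v)))).

(** Both sides of the equation for ball masses are homogeneous of degree 4, so
    they may be divided by the fourth power of the volume before passing to the
    limit. *)
Lemma density_exchange (u u' v : Qp) :
  rho (u + v) * rho (u - v) * rho u' ^+ 2 =
  rho u ^+ 2 * (rho (u' + v) * rho (u' - v)).
Proof.
have [N vN] : exists N, forall n, (N <= n)%N -> v != 0 -> prad p n < padic_norm v.
  have [->|v0] := eqVneq v 0; first by exists 0%N.
  have nv0 : 0 < padic_norm v by rewrite lt_def padic_norm_eq0 v0 padic_norm_ge0.
  have /(prad_small p_pr)[N Nv] := divr_gt0 nv0 (ltr0n _ 2).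
  exists N => n Nn _; rewrite (le_lt_trans (prad_le p_pr Nn))// (le_lt_trans Nv)//.
  by rewrite ltr_pdivrMr// ltr_pMr// ltr1n.
pose L n := avg n (u + v) * avg n (u - v) * (avg n u' * avg n u').
pose L' n := avg n u * avg n u * (avg n (u' + v) * avg n (u' - v)).
have LE : L @ \oo --> rho u * rho u * (rho (u' + v) * rho (u' - v)).
  have L'E : L' @ \oo --> rho u * rho u * (rho (u' + v) * rho (u' - v)).
    by apply: cvgM; apply: cvgM; exact: density_ball_cvg.
  apply: cvg_trans L'E; apply: near_eq_cvg; exists N => // n /= Nn.
  have v0 : vol n != 0 by rewrite gt_eqF.
  pose M x := fine (mu (cball (prad p n) x)).
  transitivity (M u ^+ 2 * (M (u' + v) * M (u' - v)) / vol n ^+ 4).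
    by rewrite /L' /avg -/(M _) -/(M _) -/(M _); field.
  rewrite -(exchange u u' (prad_gt0 p_pr n) (vN n Nn)).
  by rewrite /L /avg -/(M _) -/(M _) -/(M _); field.
rewrite !expr2; apply: (cvg_unique _ _ LE); first exact: norm_hausdorff.
by apply: cvgM; apply: cvgM; exact: density_ball_cvg.
Qed.

End density.

(** * The support of the density is a coset of a compact subgroup *)

Section idempotent_of_density.
Variables (p : nat) (p_pr : prime p) (p_gt2 : (2 < p)%N) (R : realType).
Local Notation Qp := (padic p_pr).
Variables (m : {measure set Qp -> \bar R}) (mu : probability Qp R) (rho : Qp -> R).
Hypotheses (m_haar : padic_haar_measure m) (mu_rho : has_density m mu rho)
  (rho_cont : continuous rho).
Hypothesis exchange : forall u u' v,
  rho (u + v) * rho (u - v) * rho u' ^+ 2 =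
  rho u ^+ 2 * (rho (u' + v) * rho (u' - v)).

Lemma density_pos : exists a, 0 < rho a.
Proof.
apply: contrapT => /forallNP rho0.
have : mu setT = 0%E.
  rewrite mu_rho.2// integral0_eq// => x _; congr (_%:E).
  by apply/eqP; rewrite eq_le mu_rho.1 andbT leNgt; apply/negP/rho0.
by rewrite probability_setT => /eqP; rewrite onee_eq0.
Qed.

Let a : Qp := sval (cid density_pos).
Let rho_a : 0 < rho a := svalP (cid density_pos).
Let f (x : Qp) : R := rho (a + x) / rho a.
Let K : set Qp := [set x | f x = 1].

Let f_cont : continuous f.
Proof.
move=> x.
have h : rho (a + y) @[y --> x] --> rho (a + x).
  exact: cvg_comp (@continuous_padicD p p_pr a x) (@rho_cont (a + x)).
exact: cvgM h (cvg_cst (rho a)^-1).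
Qed.

Let f_ge0 x : 0 <= f x.
Proof. by apply: divr_ge0; [exact: mu_rho.1|exact: ltW]. Qed.

Let f0 : f 0 = 1.
Proof. by rewrite /f addr0 divff// gt_eqF. Qed.

Let fE u v : f (u + v) * f (u - v) = f u ^+ 2 * (f v * f (- v)).
Proof.
have ra0 : rho a != 0 by rewrite gt_eqF.
apply: (@mulIf _ (rho a ^+ 4)); first by rewrite expf_neq0.
have := exchange (a + u) a v; rewrite -!addrA => h.
transitivity (rho (a + (u + v)) * rho (a + (u - v)) * rho a ^+ 2); first by rewrite /f; field.
by rewrite h /f; field.
Qed.

Let f01 u : f u = 0 \/ f u = 1.
Proof.
by have [|[]] := midpoint_eq_01 p_gt2 f_cont f_ge0 f0 fE u; [left|right].
Qed.

Let KB x y : K x -> K y -> K (x - y).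
Proof. exact: (midpoint_eq_subgroup p_gt2 f_cont f_ge0 f0 fE). Qed.

Let KD x y : K x -> K y -> K (x + y).
Proof. by move=> Kx Ky; rewrite -[y]opprK -[- y]sub0r; do 2 apply: KB => //. Qed.

Let K_closed : closed K.
Proof.
apply: (@closed_comp _ _ f [set 1]); first by move=> x _; exact: f_cont.
exact: closed_eq.
Qed.

Let K_meas : measurable K := closed_measurable_padic K_closed.

Let K_ball : exists N, cball (prad p N) 0 `<=` K.
Proof.
apply/nbhs_cball.
have /cvgrPdist_lt/(_ 1 ltr01) := @f_cont 0; rewrite f0.
apply: filterS => x; rewrite /K/=; have [->|//] := f01 x.
by rewrite subr0 normr1 ltxx.
Qed.

Let mu_coset (A : set Qp) : measurable A -> A `<=` K ->
  mu [set a + x | x in A] = ((rho a)%:E * m A)%E.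
Proof.
move=> mA AK; have mtA := translate_measurable a mA.
rewrite mu_rho.2// -(m_haar.2 a A mA) -integral_cst//.
apply: eq_integral => _ /set_mem[x /AK Kx <-]; congr (_%:E).
have ra0 : rho a != 0 by rewrite gt_eqF.
by apply: (@mulIf _ (rho a)^-1); rewrite ?invr_eq0// divff//; exact: Kx.
Qed.

Let mu_carrier : mu [set a + x | x in K] = 1%E.
Proof.
have mtK := translate_measurable a K_meas.
have : mu (~` [set a + x | x in K]) = 0%E.
  rewrite mu_rho.2; last exact: measurableC.
  rewrite integral0_eq// => x nKx; congr (_%:E).
  have [/eqP|fx] := f01 (- a + x).
    by rewrite /f addNKr mulf_eq0 invr_eq0 (gt_eqF rho_a) orbF => /eqP.
  by case: nKx; exists (- a + x) => //; rewrite addNKr.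
move=> h; rewrite -[X in mu X]setCK probability_setC ?h ?sube0//.
exact: measurableC.
Qed.

Let mK_fin : (m K < +oo)%E.
Proof.
have := mu_coset K_meas (@subset_refl _ K); rewrite mu_carrier ltey => h.
by apply/eqP => mK; move: h; rewrite mK gt0_muley ?lte_fin.
Qed.

Let K_compact : compact K.
Proof.
apply: (padic_compact K_closed) => n; have [N NK] := K_ball.
have nN := leq_maxl n N; have Nn := leq_maxr n N.
have [x Kx y|s sK] := haar_finite_cover m_haar (n := maxn n N) K_meas mK_fin.
  move=> xy; rewrite -(subrK x y); apply: KD => //; apply: NK.
  by rewrite /cball/= subr0; exact: le_trans xy (prad_le p_pr Nn).
exists s => y /sK[x xs xy]; exists x => //.
exact: le_trans xy (prad_le p_pr nN).
Qed.

(** The density is the constant [rho a] on the coset [a + K] and vanishes off it,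
    so [mu] inherits on that coset the translation invariance of [m], and the
    finite mass of [mu] bounds the volume of [K]. *)
Lemma idempotent_of_exchange : idempotent_distribution mu.
Proof.
have mN : measurable_fun setT (fun x : Qp => - a + x).
  exact: measurable_fun_continuous_padic (@continuous_padicD p p_pr (- a)).
pose F : {mfun Qp >-> Qp} := HB.pack (fun x : Qp => - a + x)
  (isMeasurableFun.Build _ _ _ _ (fun x : Qp => - a + x) mN).
pose nu : probability Qp R := distribution mu F.
exists K, nu, a; have nuE (A : set Qp) : nu A = mu [set a + x | x in A].
  by rewrite translate_preimage.
move: nuE; move: nu => nu nuE; split; first by split.
- split; first by rewrite nuE mu_carrier.
  move=> b A Kb mA AK; rewrite !nuE !mu_coset//.
  + by rewrite m_haar.2.
  + exact: translate_measurable.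
  + by move=> _ [x /AK Kx <-]; exact: KD.
- move=> A mA; rewrite /pushforward nuE; congr (mu _).
  apply/seteqP; split=> [x Ax|_ [x Ax <-]]//.
  by exists (- a + x); rewrite /= addNKr.
Qed.

End idempotent_of_density.

(** * Haar distributions give independence *)

Section halving.
Variables (p : nat) (p_pr : prime p) (p_gt2 : (2 < p)%N).
Local Notation Qp := (padic p_pr).

(** One half is the limit of the integers 2^(k-1) for 2^k tending to 1, and [K] is
    closed under multiplication by integers and under limits. *)
Lemma compact_subgroup_half (K : set Qp) (x : Qp) :
  compact_subgroup K -> K x -> K (x / 2).
Proof.
move=> [Kc K0 KB] Kx.
have KN y : K y -> K (- y) by move=> Ky; rewrite -sub0r; exact: KB.
have KD y z : K y -> K z -> K (y + z).
  by move=> Ky Kz; rewrite -[z]opprK; apply: KB => //; exact: KN.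
have Kn n y : K y -> K (n%:R * y).
  move=> Ky; elim: n => [|n ih]; first by rewrite mul0r.
  by rewrite -natr1 mulrDl mul1r; exact: KD.
have n2 : (2 : Qp) != 0 by rewrite -padic_norm_eq0 padic_norm2// oner_eq0.
have Kcl : closed K := compact_closed (@padic_hausdorff _ p_pr) Kc.
pose k n := (2 ^ (exp2 p n).-1)%N.
have E n : (k n)%:R * x = 2 ^+ exp2 p n * (x / 2).
  by rewrite natrX -[in RHS](prednK (exp2_gt0 p_pr n)) exprSr -mulrA (mulrC 2) divfK.
apply: (closed_cvg K) (cvg_exp2 p_gt2 (x := x / 2)) => //.
by apply: nearW => n; rewrite -E; exact: Kn.
Qed.

End halving.

Section independence_of_idempotent.
Variables (p : nat) (p_pr : prime p) (p_gt2 : (2 < p)%N).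
Local Notation Qp := (padic p_pr).
Variables (R : realType) (d : measure_display) (T : measurableType d)
  (P : probability T R) (xi eta : {RV P >-> Qp}) (mu : probability Qp R).
Hypotheses (xi_eta_indep : independent_rv P xi eta)
  (xi_mu : has_distribution xi mu) (eta_mu : has_distribution eta mu).
Local Open Scope ereal_scope.

Lemma joint_law (C : set (Qp * Qp)) : measurable C ->
  P ((fun w => (xi w, eta w)) @^-1` C) = (mu \x mu) C.
Proof.
move=> mC; have mpair : measurable_fun setT (fun w => (xi w, eta w)).
  by apply: measurable_fun_pair; exact: measurable_funPT.
pose X : {mfun T >-> (Qp * Qp)%type} := HB.pack (fun w => (xi w, eta w))
  (isMeasurableFun.Build _ _ _ _ (fun w => (xi w, eta w)) mpair).
rewrite (product_measure_unique (m' := distribution P X))// => A B mA mB.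
apply: (etrans (xi_eta_indep mA mB)).
by congr (_ * _); [exact: xi_mu|exact: eta_mu].
Qed.

Variables (K : set Qp) (a : Qp).
Hypotheses (K_sub : compact_subgroup K)
  (mu_carrier : mu ((fun x => x - a)%R @^-1` K) = 1)
  (mu_inv : forall (k : Qp) (A : set Qp), K k -> measurable A ->
     mu ((fun x => x + k)%R @^-1` A) = mu A).

Lemma measurable_preim (f : Qp -> Qp) (A : set Qp) : continuous f -> measurable A ->
  measurable (f @^-1` A).
Proof.
move=> fc mA; rewrite -[X in measurable X]setTI.
exact: (measurable_fun_continuous_padic fc).
Qed.

Let N := (fun x => x - a)%R @^-1` K.

Let N_meas : measurable N.
Proof.
apply: measurable_preim; first by under eq_fun do rewrite addrC; exact: continuous_padicD.
apply: closed_measurable_padic; apply: compact_closed; last by case: K_sub.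
exact: padic_hausdorff.
Qed.

(** Almost every point lies in the coset [N], so slices need only be compared
    there. *)
Let eq_on_carrier (f g : Qp -> \bar R) : measurable_fun setT f -> measurable_fun setT g ->
  (forall x, 0 <= f x) -> (forall x, 0 <= g x) -> (forall x, N x -> f x = g x) ->
  \int[mu]_x f x = \int[mu]_x g x.
Proof.
move=> mf mg f0 g0 fg; apply: ge0_ae_eq_integral => //.
exists (~` N); split.
- exact: measurableC.
- by rewrite /= probability_setC// mu_carrier subee.
- by move=> x /= nfg Nx; apply: nfg => _; exact: fg.
Qed.

Let product12 (C : set (Qp * Qp)) : measurable C -> (mu \x mu) C = (mu \x^ mu) C.
Proof.
move=> mC; apply: (product_measure_unique (m' := mu \x^ mu)) => // A B mA mB.
exact: product_measure2E.
Qed.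

(** Slice first along eta: for eta in the coset of [K], translating xi by eta - a
    turns the event [C] into [C'].  Then slice along xi: the condition on xi - a no
    longer involves eta, and the law of 2 eta + (xi - a) does not depend on xi. *)
Lemma sum_diff_law (A B : set Qp) : measurable A -> measurable B ->
  P ((fun w => xi w + eta w)%R @^-1` A `&` (fun w => xi w - eta w)%R @^-1` B) =
  mu ((fun x => 2 * x)%R @^-1` A) * mu ((fun x => x - a)%R @^-1` B).
Proof.
move=> mA mB.
have mfst : measurable_fun [set: Qp * Qp] fst := measurable_fst.
have msnd : measurable_fun [set: Qp * Qp] snd := measurable_snd.
have mca (c : Qp) : measurable_fun [set: Qp * Qp] (fun=> c) := measurable_cst _.
pose C := (fun z : Qp * Qp => z.1 + z.2)%R @^-1` A `&`
          (fun z : Qp * Qp => z.1 - z.2)%R @^-1` B.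
pose C' := (fun z : Qp * Qp => z.1 + (z.2 + z.2) - a)%R @^-1` A `&`
           (fun z : Qp * Qp => z.1 - a)%R @^-1` B.
have mC : measurable C.
  apply: measurableI; rewrite -[X in measurable X]setTI.
    exact: (measurable_fun_padicD mfst msnd).
  exact: (measurable_fun_padicB mfst msnd).
have mC' : measurable C'.
  apply: measurableI; rewrite -[X in measurable X]setTI.
    exact: (measurable_fun_padicB (measurable_fun_padicD mfst (measurable_fun_padicD msnd msnd)) (mca a)).
  exact: (measurable_fun_padicB mfst (mca a)).
pose mA2 : measurable ((fun x => 2 * x)%R @^-1` A) :=
  measurable_preim (@continuous_padicM p p_pr 2) mA.
have mBa : measurable ((fun x => x - a)%R @^-1` B).
  by apply: measurable_preim => //; under eq_fun do rewrite addrC; exact: continuous_padicD.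
transitivity ((mu \x mu) C); first by rewrite -joint_law.
transitivity ((mu \x^ mu) C'); rewrite ?product12//.
  apply: eq_on_carrier => [| | y| y|].
  - exact: measurable_fun_ysection.
  - exact: measurable_fun_ysection.
  - exact: measure_ge0.
  - exact: measure_ge0.
  move=> y Ny /=; rewrite -(mu_inv Ny (measurable_ysection _ mC)); congr (mu _).
  have E1 x : (x + (y - a) + y = x + (y + y) - a)%R by rewrite !addrA [LHS]addrAC addrAC.
  have E2 x : (x + (y - a) - y = x - a)%R by rewrite -addrA -addrA [(- a - y)%R]addrC addNKr.
  rewrite !ysectionE; apply/seteqP; split=> x; rewrite /C/C'/= E1 E2; exact.
rewrite -product12//.
transitivity (\int[mu]_x (mu ((fun x => 2 * x)%R @^-1` A) *
    (\1_((fun x => x - a)%R @^-1` B) x)%:E)); last first.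
  rewrite ge0_integralZl//; last by apply/measurable_EFinP; exact: measurable_indic.
  by rewrite integral_indic// setIT.
apply: eq_on_carrier.
- exact: measurable_fun_xsection.
- apply: emeasurable_funM => //; apply/measurable_EFinP; exact: measurable_indic.
- by move=> x; exact: measure_ge0.
- by move=> x; rewrite mule_ge0// lee_fin.
move=> x Nx /=; rewrite xsectionE indicE.
have [xB|xB] := boolP (x \in _); last first.
  rewrite mule0 (_ : _ @^-1` C' = set0) ?measure0// -subset0 => y [_ /=].
  by move: xB => /negP xB ?; apply: xB; rewrite inE.
rewrite mule1 -(mu_inv (compact_subgroup_half p_gt2 K_sub Nx) mA2); congr (mu _).
have n2 : ((2 : Qp) != 0)%R by rewrite -padic_norm_eq0 padic_norm2// oner_eq0.
have E y : (2 * (y + (x - a) / 2) = x + (y + y) - a)%R by field.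
apply/seteqP; split=> y; rewrite /C'/= E; first by case.
by move=> yA; split=> //; exact: set_mem xB.
Qed.

Lemma independent_of_invariant :
  independent_rv P (fun w : T => xi w + eta w)%R (fun w : T => (xi w - eta w) ^+ 2)%R.
Proof.
move=> A B mA mB.
pose B2 := (fun x : Qp => x ^+ 2)%R @^-1` B.
have mB2 : measurable B2 := measurable_preim (@continuous_padic_sqr p p_pr) mB.
rewrite -[X in _ `&` X]/((fun w => xi w - eta w)%R @^-1` B2).
rewrite -[X in _ * P X]/((fun w => xi w - eta w)%R @^-1` B2).
have := sum_diff_law measurableT mB2; have := sum_diff_law mA measurableT.
rewrite !preimage_setT setTI setIT !probability_setT mule1 mul1e => -> ->.
exact: sum_diff_law.
Qed.

End independence_of_idempotent.

Section idempotent_invariance.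
Variables (p : nat) (p_pr : prime p) (R : realType).
Local Notation Qp := (padic p_pr).
Local Open Scope ereal_scope.

(** A Haar distribution is carried by [K], so its invariance extends from subsets
    of [K] to all measurable sets. *)
Lemma haar_invariance (K : set Qp) (nu : probability Qp R) (k : Qp) (A : set Qp) :
  compact_subgroup K -> haar_distribution K nu -> K k -> measurable A ->
  nu ((fun x => x + k)%R @^-1` A) = nu A.
Proof.
move=> [Kc K0 KB] [nuK nu_inv] Kk mA.
have mK : measurable K.
  by apply: closed_measurable_padic; apply: compact_closed => //; exact: padic_hausdorff.
have nuI B : measurable B -> nu (B `&` K) = nu B.
  move=> mB; rewrite [RHS](measureDI _ mB mK) [X in X + _](_ : _ = 0) ?add0e//.
  apply/eqP; rewrite eq_le measure_ge0 andbT.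
  have <- : nu (~` K) = 0 by rewrite probability_setC// nuK subee.
  by apply: le_measure; rewrite ?inE; [exact: measurableD|exact: measurableC|move=> x []].
have KN : K (- k)%R by rewrite -sub0r; exact: KB.
have preE B : (fun x => x + k)%R @^-1` B = [set (- k + x)%R | x in B].
  by rewrite translate_preimage opprK; apply/seteqP; split=> x /=; rewrite addrC.
have mpre B : measurable B -> measurable ((fun x => x + k)%R @^-1` B).
  by move=> mB; rewrite preE; exact: translate_measurable.
rewrite -(nuI _ (mpre _ mA)) -(nuI _ mA) -(nu_inv (- k)%R (A `&` K))//; last first.
  exact: measurableI.
rewrite -preE; congr (nu _); apply/seteqP; split=> x /= -[xA xK]; split=> //.
  by rewrite -[k]opprK; exact: KB.
by rewrite -[x](addrK k); exact: KB.
Qed.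

Lemma idempotent_invariant (mu : probability Qp R) : idempotent_distribution mu ->
  exists K a, [/\ compact_subgroup K, mu ((fun x => x - a)%R @^-1` K) = 1 &
    forall (k : Qp) (A : set Qp), K k -> measurable A ->
      mu ((fun x => x + k)%R @^-1` A) = mu A].
Proof.
move=> [K [nu [a [K_sub nuP muE]]]]; exists K, a.
have mK : measurable K.
  apply: closed_measurable_padic; apply: compact_closed; last by case: K_sub.
  exact: padic_hausdorff.
have mtr (c : Qp) (A : set Qp) : measurable A -> measurable ((fun x => x + c)%R @^-1` A).
  by apply: measurable_preim; under eq_fun do rewrite addrC; exact: continuous_padicD.
split=> //.
- rewrite muE; last exact: mtr.
  rewrite -[RHS](nuP.1); congr (nu _).
  by apply/seteqP; split=> x /=; rewrite addrAC subrr add0r.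
- move=> k A Kk mA; rewrite !muE//; last exact: mtr.
  rewrite /pushforward -[RHS](haar_invariance K_sub nuP Kk).
    by congr (nu _); apply/seteqP; split=> x /=; rewrite addrA.
  by apply: measurable_preim => //; exact: continuous_padicD.
Qed.

End idempotent_invariance.

(** * The characterization *)

Theorem theorem3 (p : nat) (p_pr : prime p) (p_gt2 : (2 < p)%N)
  (R : realType) (d : measure_display) (T : measurableType d)
  (P : probability T R) (xi eta : {RV P >-> padic p_pr})
  (mu : probability (padic p_pr) R)
  (m : {measure set (padic p_pr) -> \bar R}) (rho : padic p_pr -> R)
  (m_haar : padic_haar_measure m)
  (xi_eta_indep : independent_rv P xi eta)
  (xi_mu : has_distribution xi mu) (eta_mu : has_distribution eta mu)
  (mu_rho : has_density m mu rho) (rho_cont : continuous rho) :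
  independent_rv P (fun w : T => xi w + eta w)
                   (fun w : T => (xi w - eta w) ^+ 2) <->
  idempotent_distribution mu.
Proof.
split=> [SD|/idempotent_invariant[K [a [K_sub mu_carrier mu_inv]]]].
- apply: (idempotent_of_exchange p_gt2 m_haar mu_rho rho_cont) => u u' v.
  apply: (density_exchange m_haar mu_rho rho_cont) => r x x' y r0 ry.
  exact: (ball_exchange p_gt2 xi_eta_indep xi_mu eta_mu SD).
- exact: (independent_of_invariant p_gt2 xi_eta_indep xi_mu eta_mu
            K_sub mu_carrier mu_inv).
Qed.
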